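(* Let $X=X^\top\in\mathbb{R}^{n\times n}$ be a solution of CGCARE($\Sigma$). Let $\mathcal{R}^\star_{\ker X}$ be the largest (output-nulling) reachability subspace on the output-nulling subspace $\ker X$ of the quadruple $(A,B,C,D)$. Then $$\mathcal{R}^\star_{\ker X}=\mathcal{R}_{0,X}.$$
   Context: Let $A\in\mathbb{R}^{n\times n}$, $B,S\in\mathbb{R}^{n\times m}$, $Q\in\mathbb{R}^{n\times n}$, $R\in\mathbb{R}^{m\times m}$, with the standing assumption $\Pi=\begin{bmatrix} Q & S \\ S^\top & R \end{bmatrix}=\Pi^\top\ge 0$ ($R$ may be singular), and let $\Sigma=(A,B,\Pi)$. Fix a factorization $\Pi=\begin{bmatrix} C^\top \\ D^\top \end{bmatrix}[\,C\;\;D\,]$ with $C,D$ real, i.e. $Q=C^\top C$, $S=C^\top D$, $R=D^\top D$. $M^\dagger$ denotes the Moore–Penrose pseudo-inverse. GCARE($\Sigma$) is the equation $XA+A^\top X-(S+XB)R^\dagger(S^\top+B^\top X)+Q=0$. CGCARE($\Sigma$) is GCARE($\Sigma$) together with the condition $\ker R\subseteq\ker(S+XB)$. $G=I_m-R^\dagger R$ is the orthogonal projector onto $\ker R$. For $X=X^\top$: $S_X=S+XB$, $K_X=R^\dagger S_X^\top$, $A_X=A-BK_X$, and $\mathcal{R}_{0,X}=\operatorname{im}\,[\,BG\;\;A_XBG\;\;\cdots\;\;A_X^{n-1}BG\,]$. A subspace $\mathcal{V}\subseteq\mathbb{R}^n$ is output-nulling for $(A,B,C,D)$ if there is a matrix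 $F\in\mathbb{R}^{m\times n}$ (called a friend of $\mathcal{V}$) with $(A+BF)\mathcal{V}\subseteq\mathcal{V}\subseteq\ker(C+DF)$. For a symmetric solution $X$ of GCARE($\Sigma$), $\ker X$ is output-nulling for $(A,B,C,D)$, with friend $-K_X$. The reachability subspace $\mathcal{R}^\star_{\mathcal{V}}$ on an output-nulling subspace $\mathcal{V}$ is the smallest $(A+BF)$-invariant subspace of $\mathbb{R}^n$ containing $\mathcal{V}\cap B\ker D$, where $F$ is an arbitrary friend of $\mathcal{V}$ (it does not depend on the choice of the friend $F$). *)

(* Defs.v *)
From mathcomp Require Import all_boot all_order all_algebra.
From mathcomp Require Import boolp classical_sets reals.
From mathcomp Require Import ring.

Set Implicit Arguments.
Unset Strict Implicit.
Unset Printing Implicit Defensive.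

Import Order.TTheory GRing.Theory Num.Theory.
Local Open Scope ring_scope.

(* Vectors of K^n are columns, and a matrix acts on them by left              *)
(* multiplication; MathComp's own kermx and row spaces use the transposed     *)
(* convention, hence the detour through 'Hom and {vspace _}.                  *)
Definition mxhom (K : fieldType) (m n : nat) (M : 'M[K]_(m, n)) :
    'Hom('cV[K]_n, 'cV[K]_m) :=
  linfun (mulmx M : 'cV[K]_n -> 'cV[K]_m).

Definition ker (K : fieldType) (m n : nat) (M : 'M[K]_(m, n)) :
    {vspace 'cV[K]_n} :=
  lker (mxhom M).

Definition im (K : fieldType) (m n : nat) (M : 'M[K]_(m, n)) :
    {vspace 'cV[K]_m} :=
  limg (mxhom M).

Definition symmx (K : fieldType) (n : nat) (M : 'M[K]_n) : Prop :=
  M^T = M.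

Definition psd (K : realType) (n : nat) (M : 'M[K]_n) : Prop :=
  symmx M /\ forall v : 'cV[K]_n, 0 <= (v^T *m M *m v) 0 0.

(* The four Penrose conditions. *)
Definition penrose (K : realType) (m n : nat)
    (M : 'M[K]_(m, n)) (P : 'M[K]_(n, m)) : Prop :=
  [/\ M *m P *m M = M, P *m M *m P = P,
      (M *m P)^T = M *m P & (P *m M)^T = P *m M].

(* The default value 0 is never taken: see [pinvP] below. *)
Definition pinv (K : realType) (m n : nat) (M : 'M[K]_(m, n)) : 'M[K]_(n, m) :=
  xget 0 [set P | penrose M P]%classic.

Definition popov (K : realType) (n m : nat)
    (Q : 'M[K]_n) (S : 'M[K]_(n, m)) (R : 'M[K]_m) : 'M[K]_(n + m) :=
  block_mx Q S S^T R.

Definition S_ (K : realType) (n m : nat)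
    (B S : 'M[K]_(n, m)) (X : 'M[K]_n) : 'M[K]_(n, m) :=
  S + X *m B.

Definition K_ (K : realType) (n m : nat)
    (B S : 'M[K]_(n, m)) (R : 'M[K]_m) (X : 'M[K]_n) : 'M[K]_(m, n) :=
  pinv R *m (S_ B S X)^T.

Definition A_ (K : realType) (n m : nat) (A : 'M[K]_n)
    (B S : 'M[K]_(n, m)) (R : 'M[K]_m) (X : 'M[K]_n) : 'M[K]_n :=
  A - B *m K_ B S R X.

Definition G_ (K : realType) (m : nat) (R : 'M[K]_m) : 'M[K]_m :=
  1%:M - pinv R *m R.

Definition GCARE (K : realType) (n m : nat) (A : 'M[K]_n) (B : 'M[K]_(n, m))
    (Q : 'M[K]_n) (S : 'M[K]_(n, m)) (R : 'M[K]_m) (X : 'M[K]_n) : Prop :=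
  X *m A + A^T *m X - (S + X *m B) *m pinv R *m (S^T + B^T *m X) + Q = 0.

Definition CGCARE (K : realType) (n m : nat) (A : 'M[K]_n) (B : 'M[K]_(n, m))
    (Q : 'M[K]_n) (S : 'M[K]_(n, m)) (R : 'M[K]_m) (X : 'M[K]_n) : Prop :=
  GCARE A B Q S R X /\ (ker R <= ker (S + X *m B)%R)%VS.

Definition R0_ (K : realType) (n m : nat) (A : 'M[K]_n)
    (B S : 'M[K]_(n, m)) (R : 'M[K]_m) (X : 'M[K]_n) : {vspace 'cV[K]_n} :=
  im (\mxrow_(i < n) (A_ A B S R X ^+ i *m (B *m G_ R))).

Definition friend (K : fieldType) (n m p : nat)
    (A : 'M[K]_n) (B : 'M[K]_(n, m)) (C : 'M[K]_(p, n)) (D : 'M[K]_(p, m))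
    (V : {vspace 'cV[K]_n}) (F : 'M[K]_(m, n)) : Prop :=
  (mxhom (A + B *m F)%R @: V <= V)%VS /\ (V <= ker (C + D *m F)%R)%VS.

Definition output_nulling (K : fieldType) (n m p : nat)
    (A : 'M[K]_n) (B : 'M[K]_(n, m)) (C : 'M[K]_(p, n)) (D : 'M[K]_(p, m))
    (V : {vspace 'cV[K]_n}) : Prop :=
  exists F : 'M[K]_(m, n), friend A B C D V F.

Definition smallest_invariant (K : fieldType) (n : nat) (M : 'M[K]_n)
    (W0 W : {vspace 'cV[K]_n}) : Prop :=
  [/\ (mxhom M @: W <= W)%VS, (W0 <= W)%VS &
      forall U : {vspace 'cV[K]_n},
        (mxhom M @: U <= U)%VS -> (W0 <= U)%VS -> (W <= U)%VS].

Definition is_reachability_subspace_on (K : fieldType) (n m p : nat)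
    (A : 'M[K]_n) (B : 'M[K]_(n, m)) (C : 'M[K]_(p, n)) (D : 'M[K]_(p, m))
    (V W : {vspace 'cV[K]_n}) : Prop :=
  forall F : 'M[K]_(m, n), friend A B C D V F ->
    smallest_invariant (A + B *m F) (V :&: (mxhom B @: ker D))%VS W.

(* The default value 0 is never taken (see [reachability_subspace_onP]), and  *)
(* the value is uniquely determined when V is output-nulling (see             *)
(* [is_reachability_subspace_on_uniq]); [ker_output_nulling] shows that ker X *)
(* is output-nulling for every symmetric solution X of GCARE.                 *)
Definition reachability_subspace_on (K : fieldType) (n m p : nat)
    (A : 'M[K]_n) (B : 'M[K]_(n, m)) (C : 'M[K]_(p, n)) (D : 'M[K]_(p, m))
    (V : {vspace 'cV[K]_n}) : {vspace 'cV[K]_n} :=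
  xget 0%VS [set W | is_reachability_subspace_on A B C D V W]%classic.

Lemma mxhomE (K : fieldType) (m n : nat) (M : 'M[K]_(m, n)) (v : 'cV[K]_n) :
  mxhom M v = M *m v.
Proof. by rewrite lfunE. Qed.

Lemma mem_ker (K : fieldType) (m n : nat) (M : 'M[K]_(m, n)) (v : 'cV[K]_n) :
  (v \in ker M) = (M *m v == 0).
Proof. by rewrite memv_ker mxhomE. Qed.

Lemma invariantP (K : fieldType) (n : nat) (M : 'M[K]_n)
    (V : {vspace 'cV[K]_n}) :
  reflect (forall v, v \in V -> M *m v \in V) (mxhom M @: V <= V)%VS.
Proof.
apply: (iffP subvP) => [h v vV | h _ /memv_imgP[v vV ->]].
  by rewrite -mxhomE; apply/h/memv_img.
by rewrite mxhomE; apply: h.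
Qed.

Lemma mulmx_trmx_eq0 (K : realType) (m n : nat) (M : 'M[K]_(m, n)) :
  M *m M^T = 0 -> M = 0.
Proof.
move=> h; apply/matrixP => i j; rewrite mxE.
have : (M *m M^T) i i = 0 by rewrite h mxE.
rewrite mxE => /psumr_eq0P h0; apply/eqP; rewrite -sqrf_eq0 expr2.
rewrite -[X in _ * X]/(M i j) -{2}[M]trmxK [X in _ * X]mxE h0 // => k _.
by rewrite mxE -expr2 sqr_ge0.
Qed.

Lemma row_free_gram (K : realType) (m n : nat) (M : 'M[K]_(m, n)) :
  row_free M -> M *m M^T \in unitmx.
Proof.
move=> Mfree; rewrite -row_free_unit; apply: inj_row_free => v h.
apply: (row_free_inj Mfree); rewrite mul0mx; apply: mulmx_trmx_eq0.
by rewrite trmx_mul -mulmxA [M *m _]mulmxA !mulmxA -[v *m M *m _]mulmxA h mul0mx.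
Qed.

Lemma penrose_ex (K : realType) (m n : nat) (M : 'M[K]_(m, n)) :
  exists P, penrose M P.
Proof.
suff : exists P, penrose (col_base M *m row_base M) P by rewrite mulmx_base.
have : row_free (col_base M)^T by rewrite /row_free mxrank_tr; apply: col_base_full.
have := row_base_free M.
move: (\rank M) (col_base M) (row_base M) => k c r rfree cfree.
have rU := row_free_gram rfree; have cU := row_free_gram cfree.
rewrite trmxK in cU.
have [r' [rr' r'r]] : exists r', r *m r' = 1%:M /\ (r' *m r)^T = r' *m r.
  exists (r^T *m invmx (r *m r^T)); split; first by rewrite mulmxA mulmxV.
  by rewrite !trmx_mul trmxK trmx_inv !trmx_mul trmxK mulmxA.
have [c' [c'c cc']] : exists c', c' *m c = 1%:M /\ (c *m c')^T = c *m c'.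
  exists (invmx (c^T *m c) *m c^T); split; first by rewrite -mulmxA mulVmx.
  by rewrite !trmx_mul trmxK trmx_inv !trmx_mul trmxK mulmxA.
have MP : (c *m r) *m (r' *m c') = c *m c'.
  by rewrite mulmxA -[c *m r *m r']mulmxA rr' mulmx1.
have PM : (r' *m c') *m (c *m r) = r' *m r.
  by rewrite mulmxA -[r' *m c' *m c]mulmxA c'c mulmx1.
exists (r' *m c'); split; rewrite ?MP ?PM //.
  by rewrite mulmxA -[c *m c' *m c]mulmxA c'c mulmx1.
by rewrite mulmxA -[r' *m r *m r']mulmxA rr' mulmx1.
Qed.

Lemma pinvP (K : realType) (m n : nat) (M : 'M[K]_(m, n)) :
  penrose M (pinv M).
Proof. exact: (xgetPex 0 (penrose_ex M)). Qed.

Lemma penrose_uniq (K : realType) (m n : nat) (M : 'M[K]_(m, n))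
    (P1 P2 : 'M[K]_(n, m)) :
  penrose M P1 -> penrose M P2 -> P1 = P2.
Proof.
move=> [a1 b1 c1 d1] [a2 b2 c2 d2].
have e1 : M *m P1 = M *m P2.
  by rewrite -[LHS]c1 -{1}a2 -[M *m P2 *m M *m P1]mulmxA trmx_mul c1 c2 mulmxA a1.
have e2 : P1 *m M = P2 *m M.
  by rewrite -[LHS]d1 -{1}a2 !mulmxA -[P1 *m M *m P2 *m M]mulmxA trmx_mul d1 d2
             -mulmxA [M *m (P1 *m M)]mulmxA a1.
by rewrite -b1 -mulmxA e1 mulmxA e2 b2.
Qed.

Lemma smallest_invariant_ex (K : fieldType) (n : nat) (M : 'M[K]_n)
    (W0 : {vspace 'cV[K]_n}) :
  exists W, smallest_invariant M W0 W.
Proof.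
pose good (U : {vspace 'cV[K]_n}) := (mxhom M @: U <= U)%VS && (W0 <= U)%VS.
pose P d := `[< exists2 U, good U & \dim U = d >].
have exP : exists d, P d.
  exists (\dim {:'cV[K]_n}); apply/asboolP; exists fullv => //.
  by rewrite /good !subvf.
case: (ex_minnP exP) => d /asboolP[W /andP[Winv W0W] dimW] dmin.
exists W; split=> // U Uinv W0U.
have gWU : good (W :&: U)%VS.
  rewrite /good subv_cap W0W W0U !andbT; apply/invariantP => v.
  by move=> /memv_capP[vW vU]; rewrite memv_cap !(invariantP _ _ _).
have : (d <= \dim (W :&: U))%N by apply: dmin; apply/asboolP; exists (W :&: U)%VS.
rewrite -dimW => le_dim; suff <- : (W :&: U)%VS = W by apply: capvSr.
by apply/eqP; rewrite eqEdim capvSl.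
Qed.

Lemma friend_change (K : fieldType) (n m p : nat)
    (A : 'M[K]_n) (B : 'M[K]_(n, m)) (C : 'M[K]_(p, n)) (D : 'M[K]_(p, m))
    (V U : {vspace 'cV[K]_n}) (F1 F2 : 'M[K]_(m, n)) :
    friend A B C D V F1 -> friend A B C D V F2 ->
    (U <= V)%VS -> (V :&: (mxhom B @: ker D) <= U)%VS ->
  (mxhom (A + B *m F1)%R @: U <= U)%VS -> (mxhom (A + B *m F2)%R @: U <= U)%VS.
Proof.
move=> [/invariantP i1 /subvP k1] [/invariantP i2 /subvP k2] /subvP UV /subvP WU.
move=> /invariantP iU; apply/invariantP => v vU; have vV := UV v vU.
have -> : (A + B *m F2) *m v = (A + B *m F1) *m v
    + ((A + B *m F2) *m v - (A + B *m F1) *m v) by rewrite [RHS]addrC subrK.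
rewrite memvD ?iU // WU // memv_cap memvB ?i1 ?i2 //=.
have -> : (A + B *m F2) *m v - (A + B *m F1) *m v
    = mxhom B ((F2 - F1) *m v).
  by rewrite mxhomE -mulmxBl opprD addrACA subrr add0r -mulmxBr mulmxA.
apply: memv_img; rewrite mem_ker mulmxA.
have -> : D *m (F2 - F1) = (C + D *m F2) - (C + D *m F1).
  by rewrite opprD addrACA subrr add0r mulmxBr.
have := k1 v vV; have := k2 v vV; rewrite !mem_ker mulmxBl => /eqP-> /eqP->.
by rewrite subrr.
Qed.

Lemma reachability_subspace_onP (K : fieldType) (n m p : nat)
    (A : 'M[K]_n) (B : 'M[K]_(n, m)) (C : 'M[K]_(p, n)) (D : 'M[K]_(p, m))
    (V : {vspace 'cV[K]_n}) :
  is_reachability_subspace_on A B C D V (reachability_subspace_on A B C D V).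
Proof.
apply: (xgetPex 0%VS).
have [[F1 fF1] | noF] := pselect (output_nulling A B C D V); last first.
  by exists 0%VS => F fF; case: noF; exists F.
have [W [Winv W0W Wmin]] :=
  smallest_invariant_ex (A + B *m F1) (V :&: (mxhom B @: ker D))%VS.
have WV : (W <= V)%VS by apply: Wmin; [case: fF1 | apply: capvSl].
exists W => F2 fF2; split=> // [|U Uinv W0U].
  exact: friend_change fF1 fF2 WV W0W Winv.
suff : (W <= U :&: V)%VS by rewrite subv_cap => /andP[].
have W0UV : (V :&: (mxhom B @: ker D) <= U :&: V)%VS.
  by rewrite subv_cap W0U capvSl.
apply: Wmin => //; apply: (friend_change fF2 fF1 (capvSr _ _) W0UV).
apply/invariantP => v /memv_capP[vU vV].
have [/invariantP iV _] := fF2.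
by rewrite memv_cap iV // andbT; move/invariantP: Uinv; apply.
Qed.

Lemma is_reachability_subspace_on_uniq (K : fieldType) (n m p : nat)
    (A : 'M[K]_n) (B : 'M[K]_(n, m)) (C : 'M[K]_(p, n)) (D : 'M[K]_(p, m))
    (V W1 W2 : {vspace 'cV[K]_n}) :
    output_nulling A B C D V ->
    is_reachability_subspace_on A B C D V W1 ->
  is_reachability_subspace_on A B C D V W2 -> W1 = W2.
Proof.
move=> [F fF] /(_ F fF)[i1 s1 m1] /(_ F fF)[i2 s2 m2].
by apply/eqP; rewrite eqEsubv m1 // m2.
Qed.

Lemma ker_output_nulling (K : realType) (n m p : nat)
    (A : 'M[K]_n) (B : 'M[K]_(n, m))
    (Q : 'M[K]_n) (S : 'M[K]_(n, m)) (R : 'M[K]_m)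
    (C : 'M[K]_(p, n)) (D : 'M[K]_(p, m)) (X : 'M[K]_n) :
    popov Q S R = col_mx C^T D^T *m row_mx C D ->
    symmx X -> GCARE A B Q S R X ->
  friend A B C D (ker X) (- K_ B S R X).
Proof.
rewrite /popov mul_col_row => /eq_block_mx[eQ eS _ eR] Xs ric.
have Rs : R^T = R by rewrite eR trmx_mul trmxK.
have Ps : (pinv R)^T = pinv R.
  apply: penrose_uniq (pinvP R); have [h1 h2 h3 h4] := pinvP R.
  split; apply: trmx_inj; rewrite !trmx_mul !trmxK Rs.
  - by rewrite mulmxA.
  - by rewrite mulmxA.
  - by rewrite -h4 trmx_mul Rs.
  - by rewrite -h3 trmx_mul Rs.
have [_ PRP _ _] := pinvP R.
set E := C - D *m K_ B S R X; set L := A_ A B S R X.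
have id : X *m L + L^T *m X + E^T *m E = 0.
  rewrite -ric /E /L /A_; set Kx := K_ B S R X.
  have KRK : Kx^T *m (D^T *m D) *m Kx = (S + X *m B) *m Kx.
    rewrite -eR /Kx /K_ /S_ trmx_mul trmxK Ps !mulmxA.
    by rewrite -[in RHS]PRP !mulmxA.
  have trSX : (S + X *m B)^T = S^T + B^T *m X.
    by rewrite [LHS]linearD /= trmx_mul Xs.
  rewrite -trSX.
  rewrite -mulmxA -/(K_ B S R X) -/Kx.
  have TK : (S + X *m B) *m Kx = Kx^T *m (S + X *m B)^T.
    by rewrite /Kx /K_ /S_ trmx_mul trmxK Ps !mulmxA.
  have TE : (S + X *m B) *m Kx = S *m Kx + X *m B *m Kx by rewrite mulmxDl.
  have TE' : Kx^T *m (S + X *m B)^T = Kx^T *m S^T + Kx^T *m B^T *m X.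
    by rewrite trSX mulmxDr mulmxA.
  clearbody Kx; move: KRK TK; rewrite TE TE' => KRK TK.
  have trB a b (U V : 'M[K]_(a, b)) : (U - V)^T = U^T - V^T.
    by rewrite [LHS]linearB.
  rewrite !trB !trmx_mul !mulmxBr !mulmxBl !mulmxA -eQ.
  rewrite !mulmxA in KRK; rewrite KRK -eS.
  have -> : Kx^T *m D^T *m C = Kx^T *m S^T by rewrite eS trmx_mul trmxK mulmxA.
  have -> : Kx^T *m S^T = S *m Kx + X *m B *m Kx - Kx^T *m B^T *m X.
    by rewrite TK addrK.
  move: (S *m Kx) (X *m B *m Kx) (Kx^T *m B^T *m X) (X *m A) (A^T *m X).
  move=> *; apply/matrixP => i j; rewrite !mxE; ring.
move: (erefl E) (erefl L); rewrite {1}/E {1}/L; clearbody E L => eE eL.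
have EL v : X *m v = 0 -> E *m v = 0 /\ X *m (L *m v) = 0.
  move=> Xv; have vX : v^T *m X = 0 by rewrite -[X]Xs -trmx_mul Xv trmx0.
  have : v^T *m (X *m L + L^T *m X + E^T *m E) *m v = 0 by rewrite id mulmx0 mul0mx.
  rewrite !mulmxDr !mulmxDl !mulmxA vX !mul0mx add0r.
  rewrite -[_ *m X *m v]mulmxA Xv mulmx0 add0r -trmx_mul -mulmxA => h.
  have Ev : E *m v = 0.
    by apply: trmx_inj; rewrite trmx0; apply: mulmx_trmx_eq0; rewrite trmxK.
  split=> //; have := congr1 (mulmx^~ v) id.
  by rewrite !mulmxDl -!mulmxA Xv Ev !mulmx0 !addr0 mul0mx.
split; rewrite mulmxN.
  rewrite -/(A_ A B S R X) eL; apply/invariantP => v.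
  by rewrite !mem_ker => /eqP/EL[_ ->].
by rewrite eE; apply/subvP => v; rewrite !mem_ker => /eqP/EL[-> _].
Qed.

(* Main.v *)
(* If D v = 0 then R v = 0 and S v = 0, so the kernel condition of CGCARE     *)
(* gives X B v = 0: hence B ker D lies in ker X, and ker X :&: B ker D is     *)
(* B ker D = B ker R = im (B G).  With the friend -K_X, the reachability      *)
(* subspace on ker X is the smallest A_X-invariant subspace containing        *)
(* im (B G), which by Cayley-Hamilton is the Krylov subspace R_{0,X}.         *)
Require Import Defs.
From mathcomp Require Import all_boot all_order all_algebra.
From mathcomp Require Import boolp classical_sets reals.
Import GRing.Theory Num.Theory.
Local Open Scope ring_scope.

(** Both sides solve the same minimality problem, so [smallest_invariant_uniq] identifies them. The
    friend [-K_X] from [ker_output_nulling] has closed-loop matrix [A_X], and [ker_gram], [im_G] and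
    [im_mul] turn the generating subspace [B ker D] into [im (B G)]. [smallest_invariant_krylov]
    then says that the Krylov subspace is the least [A_X]-invariant subspace above it. *)

Lemma imP (K : fieldType) (m n : nat) (M : 'M[K]_(m, n)) (v : 'cV[K]_m) :
  reflect (exists u, v = M *m u) (v \in im M).
Proof.
apply: (iffP memv_imgP) => [[u _ ->] | [u ->]]; exists u; rewrite ?memvf //.
  by rewrite mxhomE.
by rewrite mxhomE.
Qed.

Lemma im_mxrowP (K : fieldType) (n m k : nat) (N : 'I_k -> 'M[K]_(n, m))
    (v : 'cV[K]_n) :
  reflect (exists u : 'I_k -> 'cV[K]_m, v = \sum_i N i *m u i)
          (v \in im (\mxrow_i N i)).
Proof.
apply: (iffP (imP _ _ _ _ _)) => [[u ->] | [u ->]].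
  by exists (submxcol u); rewrite -{1}[u]submxcolK mul_mxrow_mxcol.
by exists (\mxcol_i u i); rewrite mul_mxrow_mxcol.
Qed.

Lemma mem_im_mxrow (K : fieldType) (n m k : nat) (N : 'I_k -> 'M[K]_(n, m))
    (i : 'I_k) (u : 'cV[K]_m) :
  N i *m u \in im (\mxrow_i N i).
Proof.
apply/im_mxrowP; exists (fun j => if j == i then u else 0).
rewrite (bigD1 i) //= eqxx big1 ?addr0 // => j /negPf ->.
by rewrite mulmx0.
Qed.

Lemma mulmx_expr (K : fieldType) (n k : nat) (M : 'M[K]_n) :
  M ^+ k.+1 = M *m M ^+ k.
Proof. by rewrite exprS. Qed.

(** The characteristic polynomial is monic, so Cayley-Hamilton can be solved for its leading
    term. *)
Lemma Cayley_Hamilton_expr (K : fieldType) (n : nat) (M : 'M[K]_n.+1) :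
  M ^+ n.+1 = - \sum_(i < n.+1) (char_poly M)`_i *: M ^+ i.
Proof.
have := Cayley_Hamilton M.
rewrite -{1}[char_poly M]coefK poly_def size_char_poly big_ord_recr /=.
have /monicP := char_poly_monic M.
rewrite lead_coefE size_char_poly /= => ->.
rewrite scale1r rmorphD rmorph_sum /= rmorphXn /= horner_mx_X => /eqP.
rewrite addrC addr_eq0 => /eqP ->; congr (- _); apply: eq_bigr => i _.
by rewrite linearZ /= rmorphXn /= horner_mx_X.
Qed.

(** Multiplying by [M] shifts each block to the next; only the last one leaves the list, and
    Cayley-Hamilton folds it back. Minimality is an induction on the power of [M]. *)
Lemma smallest_invariant_krylov (K : fieldType) (n m : nat) (M : 'M[K]_n)
    (N : 'M[K]_(n, m)) :
  smallest_invariant M (im N) (im (\mxrow_(i < n) (M ^+ i *m N))).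
Proof.
split.
- apply/invariantP => _ /im_mxrowP[u ->]; rewrite mulmx_sumr.
  apply: memv_suml => i _; rewrite !mulmxA -mulmx_expr.
  case: n M N i u => [|n] M N i u; first by case: i.
  (* Either [i.+1] still indexes a block, or [i] is the last index and the power is [n.+1]. *)
  have [lt_in|] := ltnP i.+1 n.+1.
    exact: (mem_im_mxrow _ _ _ _ (fun i => M ^+ i *m N) (Ordinal lt_in)).
  rewrite ltnS leq_eqVlt ltnNge -ltnS ltn_ord orbF => /eqP <-.
  rewrite Cayley_Hamilton_expr !mulNmx memvN !mulmx_suml.
  apply: memv_suml => j _; rewrite -!scalemxAl memvZ //.
  exact: (mem_im_mxrow _ _ _ _ (fun i => M ^+ i *m N) j).
- apply/subvP => _ /imP[u ->].
  (* In dimension 0 there is no block of index 0 to use, but every vector is zero. *)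
  case: n M N => [|n] M N; first by rewrite [N *m u]flatmx0 mem0v.
  have := mem_im_mxrow _ _ _ _ (fun i : 'I_n.+1 => M ^+ i *m N) ord0 u.
  by rewrite expr0 mul1mx.
move=> U /invariantP Uinv /subvP NU; apply/subvP => _ /im_mxrowP[u ->].
apply: memv_suml => i _.
elim: (nat_of_ord i) => [|k IH].
  by rewrite expr0 mul1mx; apply/NU/imP; exists (u i).
by rewrite mulmx_expr -!mulmxA Uinv // mulmxA.
Qed.

Lemma smallest_invariant_uniq (K : fieldType) (n : nat) (M : 'M[K]_n)
    (W0 W1 W2 : {vspace 'cV[K]_n}) :
  smallest_invariant M W0 W1 -> smallest_invariant M W0 W2 -> W1 = W2.
Proof.
move=> [i1 s1 m1] [i2 s2 m2].
by apply/eqP; rewrite eqEsubv m1 // m2.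
Qed.

(** If [D^T D v = 0] then [(D v)^T (D v) = 0], a sum of real squares, so [D v = 0]. *)
Lemma ker_gram (K : realType) (m p : nat) (D : 'M[K]_(p, m)) :
  ker (D^T *m D) = ker D.
Proof.
apply/vspaceP => v; rewrite !mem_ker; apply/eqP/eqP => [h|h].
  apply: trmx_inj; rewrite trmx0; apply: mulmx_trmx_eq0.
  by rewrite trmxK trmx_mul -mulmxA [D^T *m _]mulmxA h mulmx0.
by rewrite -mulmxA h mulmx0.
Qed.

(** The Penrose identity for [R] gives [R G = 0], and [G] fixes every vector of [ker R]. *)
Lemma im_G (K : realType) (m : nat) (R : 'M[K]_m) : im (G_ R) = ker R.
Proof.
have [RPR _ _ _] := pinvP R.
apply/vspaceP => v; rewrite mem_ker; apply/imP/eqP => [[u ->] | Rv].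
  by rewrite mulmxA /G_ mulmxBr mulmx1 mulmxA RPR subrr mul0mx.
by exists v; rewrite /G_ mulmxBl mul1mx -mulmxA Rv mulmx0 subr0.
Qed.

Lemma im_mul (K : fieldType) (m n p : nat) (M : 'M[K]_(m, n))
    (N : 'M[K]_(n, p)) :
  im (M *m N) = (mxhom M @: im N)%VS.
Proof.
apply/vspaceP => v; apply/imP/memv_imgP => [[u ->] | [_ /imP[u ->] ->]].
  by exists (N *m u); rewrite ?mxhomE ?mulmxA //; apply/imP; exists u.
by exists u; rewrite mxhomE mulmxA.
Qed.

Theorem theorem4 (K : realType) (n m p : nat)
    (A : 'M[K]_n) (B : 'M[K]_(n, m))
    (Q : 'M[K]_n) (S : 'M[K]_(n, m)) (R : 'M[K]_m)
    (C : 'M[K]_(p, n)) (D : 'M[K]_(p, m)) (X : 'M[K]_n)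
    (hPi : psd (popov Q S R))
    (hCD : popov Q S R = col_mx C^T D^T *m row_mx C D)
    (hXsym : symmx X)
    (hX : CGCARE A B Q S R X) :
  reachability_subspace_on A B C D (ker X) = R0_ A B S R X.
Proof.
have [ric /subvP kerRS] := hX.
have friendK := ker_output_nulling hCD hXsym ric.
have := reachability_subspace_onP friendK.
have [_ eS _ eR] : [/\ Q = C^T *m C, S = C^T *m D, S^T = D^T *m C & R = D^T *m D].
  by move: hCD; rewrite /popov mul_col_row => /eq_block_mx.
have kerRD : ker R = ker D by rewrite eR ker_gram.
have BkerD : (mxhom B @: ker D <= ker X)%VS.
  apply/subvP => _ /memv_imgP[v vD ->]; rewrite mem_ker mxhomE mulmxA.
  have := kerRS v; rewrite kerRD => /(_ vD).
  move: vD; rewrite !mem_ker mulmxDl eS -[C^T *m D *m v]mulmxA => /eqP ->.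
  by rewrite mulmx0 add0r.
(* The intersection with [ker X] collapses to [B ker D], and [A + B (-K_X)] becomes [A_X]. *)
rewrite (capv_idPr BkerD) -kerRD -im_G -im_mul mulmxN => reachable.
exact: smallest_invariant_uniq reachable (smallest_invariant_krylov _ _ _ _ _).
Qed.
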